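(* Let $k$ be a field with $\operatorname{char} k\neq 2$ and let $L$ be a non-abelian Lie algebra over $k$ with $\dim L=2$. Let $r\in L\otimes L$. Then $r$ is a solution of the CYBE if and only if $r$ is strongly symmetric or skew symmetric.
   Context: For a Lie algebra $L$ over $k$ and $r=\sum_i a_i\otimes b_i\in L\otimes L$, define in $L\otimes L\otimes L$: $[r^{12},r^{13}]=\sum_{i,j}[a_i,a_j]\otimes b_i\otimes b_j$, $[r^{12},r^{23}]=\sum_{i,j}a_i\otimes[b_i,a_j]\otimes b_j$, $[r^{13},r^{23}]=\sum_{i,j}a_i\otimes a_j\otimes[b_i,b_j]$. The element $r$ is a solution of the classical Yang–Baxter equation (CYBE) in $L$ if $[r^{12},r^{13}]+[r^{12},r^{23}]+[r^{13},r^{23}]=0$. Let $\{e_1,\dots,e_n\}$ be a basis of $L$ and $r=\sum_{i,j}k_{ij}(e_i\otimes e_j)$ with $k_{ij}\in k$. Then $r$ is strongly symmetric if $k_{ij}=k_{ji}$ and $k_{ij}k_{lm}=k_{il}k_{jm}$ for all $i,j,l,m$; $r$ is skew symmetric if $k_{ij}=-k_{ji}$ for all $i,j$. Both notions are independent of the choice of basis. *)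

(* Defs.v *)
From HB Require Import structures.
From mathcomp Require Import all_boot all_order all_algebra.

Set Implicit Arguments.
Unset Strict Implicit.
Unset Printing Implicit Defensive.

Import GRing.Theory.
Local Open Scope ring_scope.

HB.mixin Record isLieAlgebra (k : fieldType) L of GRing.Lmodule k L := {
  lie : L -> L -> L;
  lie_linearl : forall y : L, linear (fun x => lie x y);
  lie_linearr : forall x : L, linear (lie x);
  liexx : forall x : L, lie x x = 0;
  lie_jacobi : forall x y z : L,
    lie x (lie y z) + lie y (lie z x) + lie z (lie x y) = 0
}.

#[short(type="lieAlgType")]
HB.structure Definition LieAlgebra (k : fieldType) :=
  { L of isLieAlgebra k L & GRing.Lmodule k L }.

#[short(type="finLieAlgType")]
HB.structure Definition FinLieAlgebra (k : fieldType) :=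
  { L of isLieAlgebra k L & Vector k L }.

Definition lie_abelian (k : fieldType) (L : lieAlgType k) : Prop :=
  forall x y : L, lie x y = 0.

(* The tensor product of two finite-dimensional spaces is realised by          *)
(* coordinate matrices in the bases [vbasis fullv]; [tensor_liftE],            *)
(* [tensor_lift_linear] and [tensor_lift_uniq] are its universal property.     *)
Definition tensor (k : fieldType) (U V : vectType k) : Type :=
  'M[k]_(\dim {:U}, \dim {:V}).

HB.instance Definition _ (k : fieldType) (U V : vectType k) :=
  Vector.copy (tensor U V) 'M[k]_(\dim {:U}, \dim {:V}).

Definition tens (k : fieldType) (U V : vectType k) (u : U) (v : V) :
    tensor U V :=
  \matrix_(i, j) (coord (vbasis {:U}) i u * coord (vbasis {:V}) j v).

Notation "u \ot v" := (tens u v)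
  (at level 40, left associativity, format "u  \ot  v") : ring_scope.

(* The linear map out of [tensor U V] induced by a bilinear [f].               *)
Definition tensor_lift (k : fieldType) (U V : vectType k) (W : lmodType k)
    (f : U -> V -> W) (r : tensor U V) : W :=
  \sum_i \sum_j
    (r : 'M_(_, _)) i j *: f (vbasis {:U})`_i (vbasis {:V})`_j.

Section TensorTheory.
Variables (k : fieldType) (U V : vectType k).

Lemma tens_linearl (v : V) : linear (fun u : U => u \ot v).
Proof.
by move=> a x y; apply/matrixP=> i j; rewrite !mxE linearP mulrDl mulrA.
Qed.

Lemma tens_linearr (u : U) : linear (fun v : V => u \ot v).
Proof.
by move=> a x y; apply/matrixP=> i j; rewrite !mxE linearP mulrDr mulrCA.
Qed.

Lemma tensor_basis (r : tensor U V) :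
  r = tensor_lift (@tens k U V) r.
Proof.
apply/matrixP=> a b; rewrite /tensor_lift summxE.
rewrite (bigD1 a) //= summxE (bigD1 b) //= !mxE.
rewrite !coord_free ?(basis_free (vbasisP _)) // !eqxx !mulr1.
rewrite !big1 ?addr0 // => [i /negPf ni|j /negPf nj].
  rewrite summxE big1 // => j _.
  by rewrite !mxE coord_free ?(basis_free (vbasisP _)) // ni mul0r mulr0.
by rewrite !mxE !coord_free ?(basis_free (vbasisP _)) // nj !mulr0.
Qed.

Variable W : lmodType k.

Lemma tensor_lift_linear (f : U -> V -> W) : linear (tensor_lift f).
Proof.
move=> a x y; rewrite /tensor_lift scaler_sumr -big_split /=.
apply: eq_bigr => i _; rewrite scaler_sumr -big_split /=.
by apply: eq_bigr => j _; rewrite !mxE scalerDl scalerA.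
Qed.

Lemma linear_sumE (X Y : lmodType k) (g : X -> Y) (lg : linear g)
    I (s : seq I) (P : pred I) (F : I -> X) (c : I -> k) :
  g (\sum_(i <- s | P i) c i *: F i) = \sum_(i <- s | P i) c i *: g (F i).
Proof.
have g0 : g 0 = 0 by have := lg (-1) 0 0; rewrite !scaleN1r !addNr.
elim/big_rec2: _ => // i y x _ <-; exact: lg.
Qed.

Lemma linear_sum1E (X Y : lmodType k) (g : X -> Y) (lg : linear g)
    I (s : seq I) (P : pred I) (F : I -> X) :
  g (\sum_(i <- s | P i) F i) = \sum_(i <- s | P i) g (F i).
Proof.
have := linear_sumE lg s P F (fun=> 1).
by under eq_bigr do rewrite scale1r; under [RHS]eq_bigr do rewrite scale1r.
Qed.

Lemma tensor_liftE (f : U -> V -> W) :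
    (forall v, linear (fun u => f u v)) -> (forall u, linear (f u)) ->
  forall u v, tensor_lift f (u \ot v) = f u v.
Proof.
move=> fl fr u v; rewrite [in RHS](coord_vbasis (memvf u)) (linear_sumE (fl v)).
rewrite [in RHS](coord_vbasis (memvf v)).
apply: eq_bigr => i _; rewrite (linear_sumE (fr _)) scaler_sumr.
by apply: eq_bigr => j _; rewrite mxE scalerA.
Qed.

Lemma tensor_lift_uniq (f : U -> V -> W) (g : tensor U V -> W) :
  linear g -> (forall u v, g (u \ot v) = f u v) -> g =1 tensor_lift f.
Proof.
move=> lg gf r; rewrite {1}(tensor_basis r) /tensor_lift.
have lg1 i : g (\sum_j (r : 'M_(_, _)) i j *:
    ((vbasis {:U})`_i \ot (vbasis {:V})`_j)) =
  \sum_j (r : 'M_(_, _)) i j *: f (vbasis {:U})`_i (vbasis {:V})`_j.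
  by rewrite (linear_sumE lg); apply: eq_bigr => j _; rewrite gf.
by rewrite (linear_sum1E lg); apply: eq_bigr => i _; rewrite lg1.
Qed.

Lemma tensor_lift_sum (f : U -> V -> W) :
    (forall v, linear (fun u => f u v)) -> (forall u, linear (f u)) ->
  forall I (s : seq I) (a : I -> U) (b : I -> V),
  tensor_lift f (\sum_(i <- s) a i \ot b i) = \sum_(i <- s) f (a i) (b i).
Proof.
move=> fl fr I s a b.
rewrite (linear_sum1E (tensor_lift_linear f)).
by apply: eq_bigr => i _; rewrite tensor_liftE.
Qed.

End TensorTheory.

Section CYBE.
Variables (k : fieldType) (L : finLieAlgType k).
Implicit Type r : tensor L L.

Definition bracket12_13 r : tensor L (tensor L L) :=
  tensor_lift (fun a b =>
    tensor_lift (fun a' b' => lie a a' \ot (b \ot b')) r) r.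

Definition bracket12_23 r : tensor L (tensor L L) :=
  tensor_lift (fun a b =>
    tensor_lift (fun a' b' => a \ot (lie b a' \ot b')) r) r.

Definition bracket13_23 r : tensor L (tensor L L) :=
  tensor_lift (fun a b =>
    tensor_lift (fun a' b' => a \ot (a' \ot lie b b')) r) r.

Definition CYBE_solution r : Prop :=
  bracket12_13 r + bracket12_23 r + bracket13_23 r = 0.

Lemma tensor_lift2_sum (W : lmodType k) (f : L -> L -> L -> L -> W) :
    (forall b a' b', linear (fun a => f a b a' b')) ->
    (forall a a' b', linear (fun b => f a b a' b')) ->
    (forall a b b', linear (fun a' => f a b a' b')) ->
    (forall a b a', linear (fun b' => f a b a' b')) ->
  forall I (s : seq I) (a b : I -> L) r, r = \sum_(i <- s) a i \ot b i ->
  tensor_lift (fun x y => tensor_lift (f x y) r) r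
  = \sum_(i <- s) \sum_(j <- s) f (a i) (b i) (a j) (b j).
Proof.
move=> f1 f2 f3 f4 I s a b r ->.
have E x y : tensor_lift (f x y) (\sum_(i <- s) a i \ot b i) =
    \sum_(j <- s) f x y (a j) (b j).
  by rewrite tensor_lift_sum.
rewrite tensor_lift_sum; first by apply: eq_bigr => i _; rewrite E.
  move=> y c x x'; rewrite !E scaler_sumr -big_split /=.
  by apply: eq_bigr => j _; rewrite f1.
move=> x c y y'; rewrite !E scaler_sumr -big_split /=.
by apply: eq_bigr => j _; rewrite f2.
Qed.

Lemma bracket12_13E I (s : seq I) (a b : I -> L) r :
  r = \sum_(i <- s) a i \ot b i ->
  bracket12_13 r =
    \sum_(i <- s) \sum_(j <- s) lie (a i) (a j) \ot (b i \ot b j).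
Proof.
move=> rE; rewrite /bracket12_13.
rewrite (tensor_lift2_sum (f := fun a b a' b' => lie a a' \ot (b \ot b')) _ _ _ _ rE) //.
- by move=> ? ? ? c x y; rewrite lie_linearl tens_linearl.
- by move=> ? ? ? c x y; rewrite tens_linearl tens_linearr.
- by move=> ? ? ? c x y; rewrite lie_linearr tens_linearl.
- by move=> ? ? ? c x y; rewrite !tens_linearr.
Qed.

Lemma bracket12_23E I (s : seq I) (a b : I -> L) r :
  r = \sum_(i <- s) a i \ot b i ->
  bracket12_23 r =
    \sum_(i <- s) \sum_(j <- s) a i \ot (lie (b i) (a j) \ot b j).
Proof.
move=> rE; rewrite /bracket12_23.
rewrite (tensor_lift2_sum (f := fun a b a' b' => a \ot (lie b a' \ot b')) _ _ _ _ rE) //.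
- by move=> ? ? ? c x y; rewrite tens_linearl.
- by move=> ? ? ? c x y; rewrite lie_linearl tens_linearl tens_linearr.
- by move=> ? ? ? c x y; rewrite lie_linearr tens_linearl tens_linearr.
- by move=> ? ? ? c x y; rewrite !tens_linearr.
Qed.

Lemma bracket13_23E I (s : seq I) (a b : I -> L) r :
  r = \sum_(i <- s) a i \ot b i ->
  bracket13_23 r =
    \sum_(i <- s) \sum_(j <- s) a i \ot (a j \ot lie (b i) (b j)).
Proof.
move=> rE; rewrite /bracket13_23.
rewrite (tensor_lift2_sum (f := fun a b a' b' => a \ot (a' \ot lie b b')) _ _ _ _ rE) //.
- by move=> ? ? ? c x y; rewrite tens_linearl.
- by move=> ? ? ? c x y; rewrite lie_linearl !tens_linearr.
- by move=> ? ? ? c x y; rewrite tens_linearl tens_linearr.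
- by move=> ? ? ? c x y; rewrite lie_linearr !tens_linearr.
Qed.

End CYBE.

Section Symmetry.
Variables (k : fieldType) (V : vectType k).

Definition tensor_comb n (e : n.-tuple V) (K : 'M[k]_n) : tensor V V :=
  \sum_i \sum_j K i j *: (e`_i \ot e`_j).

Definition strongly_symmetric_coef n (K : 'M[k]_n) : Prop :=
  (forall i j, K i j = K j i) /\
  (forall i j l m, K i j * K l m = K i l * K j m).

Definition skew_symmetric_coef n (K : 'M[k]_n) : Prop :=
  forall i j, K i j = - K j i.

(* Every tensor has exactly one coefficient matrix in each basis               *)
(* ([tensor_comb_ex], [tensor_comb_inj]), and testing one basis is enough      *)
(* ([strongly_symmetricE], [skew_symmetricE]).                                 *)
Definition strongly_symmetric (r : tensor V V) : Prop :=
  forall n (e : n.-tuple V) (K : 'M[k]_n),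
    basis_of {:V} e -> r = tensor_comb e K -> strongly_symmetric_coef K.

Definition skew_symmetric (r : tensor V V) : Prop :=
  forall n (e : n.-tuple V) (K : 'M[k]_n),
    basis_of {:V} e -> r = tensor_comb e K -> skew_symmetric_coef K.

Lemma tensor_comb_change n m (e : n.-tuple V) (f : m.-tuple V) (K : 'M[k]_n) :
  basis_of {:V} f ->
  tensor_comb e K = tensor_comb f
    (\matrix_(i < m, j < m) \sum_(a < n) \sum_(b < n)
       coord f i e`_a * coord f j e`_b * K a b).
Proof.
move=> fb; rewrite /tensor_comb.
have E a b : e`_a \ot e`_b =
    \sum_i \sum_j (coord f i e`_a * coord f j e`_b) *: (f`_i \ot f`_j).
  rewrite {1}(coord_basis fb (memvf e`_a)) (linear_sumE (tens_linearl _)).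
  apply: eq_bigr => i _; rewrite {1}(coord_basis fb (memvf e`_b)).
  rewrite (linear_sumE (tens_linearr _)) scaler_sumr.
  by apply: eq_bigr => j _; rewrite scalerA.
transitivity (\sum_(a < n) \sum_(b < n) \sum_(i < m) \sum_(j < m)
   (coord f i e`_a * coord f j e`_b * K a b) *: (f`_i \ot f`_j)).
  apply: eq_bigr => a _; apply: eq_bigr => b _; rewrite E scaler_sumr.
  apply: eq_bigr => i _; rewrite scaler_sumr.
  by apply: eq_bigr => j _; rewrite scalerA mulrC.
under eq_bigr do rewrite exchange_big /=.
rewrite exchange_big /=; apply: eq_bigr => i _.
under eq_bigr do rewrite exchange_big /=.
rewrite exchange_big /=; apply: eq_bigr => j _.
rewrite mxE scaler_suml; apply: eq_bigr => a _.
by rewrite scaler_suml.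
Qed.

Lemma tensor_comb_ex n (e : n.-tuple V) (r : tensor V V) :
  basis_of {:V} e -> exists K, r = tensor_comb e K.
Proof.
move=> eb; have -> : r = tensor_comb (vbasis {:V}) (r : 'M_(_, _)).
  exact: tensor_basis.
by rewrite (tensor_comb_change _ _ eb); eexists.
Qed.

Lemma tensor_comb_inj n (e : n.-tuple V) :
  basis_of {:V} e -> injective (tensor_comb e).
Proof.
move=> eb K K' eqK; apply/matrixP=> i j.
pose phi := fun u v : V => coord e i u * coord e j v : k^o.
have phil v : linear (fun u => phi u v).
  by move=> c x y; rewrite /phi linearP mulrDl -mulrA.
have phir u : linear (phi u).
  by move=> c x y; rewrite /phi linearP mulrDr mulrCA.
have E (M : 'M_n) : tensor_lift phi (tensor_comb e M) = M i j.
  have lp := tensor_lift_linear phi.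
  transitivity (\sum_(a < n) \sum_(b < n) M a b *: phi e`_a e`_b).
    rewrite /tensor_comb (linear_sum1E lp); apply: eq_bigr => a _.
    by rewrite (linear_sumE lp); apply: eq_bigr => b _; rewrite tensor_liftE.
  rewrite (bigD1 i) //= (bigD1 j) //= /phi.
  rewrite !coord_free ?(basis_free eb) // !eqxx mulr1 [_ *: _]mulr1.
  rewrite !big1 ?addr0 // => [a /negPf na|b /negPf nb].
    rewrite big1 // => b _; rewrite coord_free ?(basis_free eb) //.
    by rewrite na mul0r scaler0.
  by rewrite !coord_free ?(basis_free eb) // nb mulr0 scaler0.
by rewrite -!E eqK.
Qed.

Lemma strongly_symmetric_coef_change n m (P : 'I_m -> 'I_n -> k) (K : 'M[k]_n) :
  strongly_symmetric_coef K ->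
  strongly_symmetric_coef
    (\matrix_(i, j) \sum_a \sum_b P i a * P j b * K a b).
Proof.
move=> [Ks Kr]; split=> [i j|i j l p]; rewrite !mxE.
  rewrite exchange_big; apply: eq_bigr => a _; apply: eq_bigr => b _.
  by rewrite Ks (mulrC (P i _)).
have E i1 i2 i3 i4 :
    (\sum_a \sum_b P i1 a * P i2 b * K a b) *
    (\sum_a \sum_b P i3 a * P i4 b * K a b) =
    \sum_a \sum_b \sum_c \sum_d
      P i1 a * P i2 b * P i3 c * P i4 d * (K a b * K c d).
  rewrite mulr_suml; apply: eq_bigr => a _; rewrite mulr_suml.
  apply: eq_bigr => b _; rewrite mulr_sumr; apply: eq_bigr => c _.
  rewrite mulr_sumr; apply: eq_bigr => d _.
  by rewrite mulrACA !mulrA.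
rewrite !E; apply: eq_bigr => a _; rewrite exchange_big /=.
apply: eq_bigr => b _; apply: eq_bigr => c _; apply: eq_bigr => d _.
by rewrite Kr (mulrAC (P i a)).
Qed.

Lemma skew_symmetric_coef_change n m (P : 'I_m -> 'I_n -> k) (K : 'M[k]_n) :
  skew_symmetric_coef K ->
  skew_symmetric_coef (\matrix_(i, j) \sum_a \sum_b P i a * P j b * K a b).
Proof.
move=> Ks i j; rewrite !mxE exchange_big -sumrN; apply: eq_bigr => a _.
rewrite -sumrN; apply: eq_bigr => b _.
by rewrite Ks mulrN (mulrC (P i _)).
Qed.

Lemma strongly_symmetricE n (e : n.-tuple V) (K : 'M[k]_n) (r : tensor V V) :
  basis_of {:V} e -> r = tensor_comb e K ->
  (strongly_symmetric r <-> strongly_symmetric_coef K).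
Proof.
move=> eb rE; split=> [rs|Ks m f K' fb]; first exact: rs eb rE.
rewrite rE (tensor_comb_change _ _ fb) => /(tensor_comb_inj fb) <-.
exact: (strongly_symmetric_coef_change (fun i a => coord f i e`_a)).
Qed.

Lemma skew_symmetricE n (e : n.-tuple V) (K : 'M[k]_n) (r : tensor V V) :
  basis_of {:V} e -> r = tensor_comb e K ->
  (skew_symmetric r <-> skew_symmetric_coef K).
Proof.
move=> eb rE; split=> [rs|Ks m f K' fb]; first exact: rs eb rE.
rewrite rE (tensor_comb_change _ _ fb) => /(tensor_comb_inj fb) <-.
exact: (skew_symmetric_coef_change (fun i a => coord f i e`_a)).
Qed.

End Symmetry.

(* Main.v *)
Require Import Defs.
From mathcomp Require Import all_boot all_order all_algebra.
From mathcomp Require Import ring.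

Set Implicit Arguments.
Unset Strict Implicit.
Unset Printing Implicit Defensive.

Import GRing.Theory.
Local Open Scope ring_scope.

(** A non-abelian Lie algebra of dimension 2 has a basis (e, f) with
    [e, f] = e: the derived algebra is a line, on which the rest of the algebra
    acts by non-zero scalars ([nonabelian_dim2_basis]). Write r as
    e (x) p + f (x) q, where p = a e + b f and q = c e + d f are the rows of
    its coefficient matrix.
    Each bracket of the algebra is a multiple of e, and every antisymmetrized
    product of p and q is a multiple of D = ad - bc, so the left-hand side of
    the classical Yang-Baxter equation collapses to
      e (x) e (x) (a q - b p + D f) + f (x) e (x) (c q - d p - D e)
    ([CYBE_lhsE]). As e and f are free, the equation is equivalent to the
    vanishing of the two vectors on the right, that is to
      a(c - b) = 0,  2ad = b(b + c),  2ad = c(b + c),  d(c - b) = 0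
    ([CYBE_solutionE]).
    If b = c this says ad = b^2 (2 being invertible), which is strong symmetry;
    if b <> c it forces a = d = 0 and then b + c = 0, which is skew symmetry.
    The converse is a substitution, where 2 <> 0 is used again to see that a
    skew-symmetric matrix has zero diagonal. *)

(** * Bilinearity of the tensor product and of the bracket *)

Section TensorBilinear.
Variables (k : fieldType) (U V : vectType k).
Implicit Types (u : U) (v : V).

Lemma tensDl u1 u2 v : (u1 + u2) \ot v = u1 \ot v + u2 \ot v.
Proof. by have := tens_linearl v 1 u1 u2; rewrite !scale1r. Qed.

Lemma tens0l v : (0 : U) \ot v = 0.
Proof. by apply: (addIr (0 \ot v)); rewrite -tensDl !add0r. Qed.

Lemma tensZl c u v : (c *: u) \ot v = c *: (u \ot v).
Proof. by have := tens_linearl v c u 0; rewrite tens0l !addr0. Qed.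

Lemma tensDr u v1 v2 : u \ot (v1 + v2) = u \ot v1 + u \ot v2.
Proof. by have := tens_linearr u 1 v1 v2; rewrite !scale1r. Qed.

Lemma tens0r u : u \ot (0 : V) = 0.
Proof. by apply: (addIr (u \ot 0)); rewrite -tensDr !add0r. Qed.

Lemma tensZr c u v : u \ot (c *: v) = c *: (u \ot v).
Proof. by have := tens_linearr u c v 0; rewrite tens0r !addr0. Qed.

(** Contracting the first factor with a coordinate form of [X] isolates each
    coefficient: the left tensor factors can be read off a free family. *)
Lemma free_tens_eq0 n (X : n.-tuple U) (T : 'I_n -> V) :
  free X -> \sum_(i < n) X`_i \ot T i = 0 -> forall i, T i = 0.
Proof.
move=> freeX sum0 i.
pose contract u v := coord X i u *: v.
have contractl v : linear (contract^~ v).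
  by move=> c x y; rewrite /contract linearP scalerDl scalerA.
have contractr u : linear (contract u).
  by move=> c x y; rewrite /contract scalerDr !scalerA mulrC.
have := tensor_lift_sum contractl contractr (index_enum 'I_n) (fun i : 'I_n => X`_i) T.
rewrite sum0 (bigD1 i) //= big1 => [|j /negPf ji].
  rewrite /contract coord_free // eqxx scale1r addr0 => <-.
  rewrite /tensor_lift big1 // => x _; rewrite big1 // => y _.
  by rewrite mxE scale0r.
by rewrite /contract coord_free // ji scale0r.
Qed.

End TensorBilinear.

Section Lie.
Variables (k : fieldType) (L : finLieAlgType k).
Implicit Types x y z e f : L.

Lemma lieDl x y z : lie (x + y) z = lie x z + lie y z.
Proof. by have := lie_linearl z 1 x y; rewrite !scale1r. Qed.

Lemma lie0l x : lie 0 x = 0.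
Proof. by apply: (addIr (lie 0 x)); rewrite -lieDl !add0r. Qed.

Lemma lieZl c x y : lie (c *: x) y = c *: lie x y.
Proof. by have := lie_linearl y c x 0; rewrite lie0l !addr0. Qed.

Lemma lieDr x y z : lie x (y + z) = lie x y + lie x z.
Proof. by have := lie_linearr x 1 y z; rewrite !scale1r. Qed.

Lemma lie0r x : lie x 0 = 0.
Proof. by apply: (addIr (lie x 0)); rewrite -lieDr !add0r. Qed.

Lemma lieZr c x y : lie x (c *: y) = c *: lie x y.
Proof. by have := lie_linearr x c y 0; rewrite lie0r !addr0. Qed.

Lemma lieC x y : lie x y = - lie y x.
Proof.
have := liexx (x + y); rewrite lieDl !lieDr !liexx add0r addr0.
by move/eqP; rewrite addr_eq0 => /eqP.
Qed.

Lemma lie_comb2 e f a b c d :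
  lie (a *: e + b *: f) (c *: e + d *: f) = (a * d - b * c) *: lie e f.
Proof.
rewrite lieDl !lieDr !lieZl !lieZr !liexx (lieC f e) !scaler0 add0r addr0.
by rewrite !scalerN !scalerA -scalerBl.
Qed.

(** * A normal form for non-abelian algebras of dimension 2 *)

(** Two linearly dependent vectors have zero bracket. *)
Lemma lie_neq0_basis x y :
  \dim {:L} = 2%N -> lie x y != 0 -> basis_of {:L} [tuple x; y].
Proof.
move=> dimL xy0; rewrite basisEfree subvf dimL /= free_cons seq1_free span_seq1.
rewrite !andbT; apply/andP; split; last first.
  by apply: contraNneq xy0 => ->; rewrite lie0r.
apply: contraNN xy0 => /vlineP[c ->].
by rewrite lieZl liexx scaler0.
Qed.

Lemma coord_basis2 x y z :
  basis_of {:L} [tuple x; y] -> exists a b, z = a *: x + b *: y.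
Proof.
move=> /coord_basis/(_ (memvf z)) ->.
by rewrite !big_ord_recl big_ord0 addr0 /=; eexists; eexists.
Qed.

(** The vector w = [x, y] spans the derived algebra. If w = a x + b y, then
    [w, y] = a w and [w, x] = - b w; as one of a, b is non-zero, a multiple of
    y or of x completes w to the required basis. *)
Lemma nonabelian_dim2_basis :
  \dim {:L} = 2%N -> ~ lie_abelian L ->
  exists e f, basis_of {:L} [tuple e; f] /\ lie e f = e.
Proof.
move=> dimL nab.
(* The bracket vanishes as soon as it does on pairs of basis vectors, so a
   finite search decides whether L is abelian and yields the pair x, y. *)
have [x [y xy0]] : exists x y : L, lie x y != 0.
  have [/existsP[i /existsP[j ?]]|/existsPn all0] := boolP
    [exists i : 'I_(\dim {:L}), exists j : 'I_(\dim {:L}),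
      lie (vbasis {:L})`_i (vbasis {:L})`_j != 0].
    by exists (vbasis {:L})`_i, (vbasis {:L})`_j.
  case: nab => x y.
  rewrite (coord_vbasis (memvf x)) (linear_sumE (lie_linearl y)) big1 // => i _.
  rewrite (coord_vbasis (memvf y)) (linear_sumE (lie_linearr _)) big1 ?scaler0 //.
  move=> j _; have /existsPn/(_ j) := all0 i.
  by rewrite negbK => /eqP->; rewrite scaler0.
suff [f ef] : exists f, lie (lie x y) f = lie x y.
  by exists (lie x y), f; split=> //; apply: lie_neq0_basis; rewrite ?ef.
have [a [b w_def]] := coord_basis2 (lie x y) (lie_neq0_basis dimL xy0).
have wy : lie (lie x y) y = a *: lie x y.
  by rewrite {1}w_def lieDl !lieZl liexx scaler0 addr0.
have wx : lie (lie x y) x = - b *: lie x y.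
  by rewrite {1}w_def lieDl !lieZl liexx scaler0 add0r lieC scalerN scaleNr.
have [a0|a0] := eqVneq a 0; last first.
  by exists (a^-1 *: y); rewrite lieZr wy scalerA mulVf // scale1r.
have b0 : - b != 0.
  rewrite oppr_eq0; apply: contra_neq xy0 => b0.
  by rewrite w_def a0 b0 !scale0r addr0.
by exists ((- b)^-1 *: x); rewrite lieZr wx scalerA mulVf // scale1r.
Qed.

(** * The classical Yang-Baxter equation in the normal form *)

Section NormalForm.
Variables (e f : L) (ef : lie e f = e).
Variables (a b c d : k).
Let p := a *: e + b *: f.
Let q := c *: e + d *: f.
Let r : tensor L L := e \ot p + f \ot q.
Let D := a * d - b * c.

(** The exterior square of a plane is a line, so p ^ q = D (e ^ f). *)
Lemma tens_antisym : p \ot q - q \ot p = D *: (e \ot f - f \ot e).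
Proof. by apply/matrixP=> i j; rewrite !mxE !linearD !linearZ /= /D; ring. Qed.

Lemma CYBE_lhsE :
  bracket12_13 r + bracket12_23 r + bracket13_23 r =
    e \ot (e \ot (a *: q - b *: p + D *: f)) +
    f \ot (e \ot (c *: q - d *: p - D *: e)).
Proof.
have rE : r = \sum_(i <- [:: (e, p); (f, q)]) i.1 \ot i.2.
  by rewrite !big_cons big_nil addr0.
rewrite (bracket12_13E rE) (bracket12_23E rE) (bracket13_23E rE).
rewrite !big_cons !big_nil /= !addr0.
have fe : lie f e = - e by rewrite lieC ef.
have pe : lie p e = - b *: e.
  by rewrite lieDl !lieZl liexx fe scaler0 add0r scalerN scaleNr.
have qe : lie q e = - d *: e.
  by rewrite lieDl !lieZl liexx fe scaler0 add0r scalerN scaleNr.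
have pf : lie p f = a *: e by rewrite lieDl !lieZl liexx ef scaler0 addr0.
have qf : lie q f = c *: e by rewrite lieDl !lieZl liexx ef scaler0 addr0.
have pq : lie p q = D *: e by rewrite lie_comb2 ef.
have qp : lie q p = - D *: e by rewrite lieC pq scaleNr.
rewrite !liexx ef fe pe qe pf qf pq qp !tens0r !tens0l !add0r !addr0.
rewrite -scaleN1r (tensZl (-1) e) -tensZr scaleN1r.
(* Gather the terms according to their first factor. *)
rewrite -!tensDr addrACA -!tensDr tens_antisym -[X in _ + X]addrA addrA -!tensDr.
by congr (_ + _); [congr (tens e _) | congr (tens f _)]; apply/matrixP=> i j;
  rewrite !mxE !linearD /= !linearN /= !linearZ /=; ring.
Qed.

(** The four equations are the coordinates of the two vectors in [CYBE_lhsE]. *)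
Lemma CYBE_solutionE : basis_of {:L} [tuple e; f] ->
  CYBE_solution r <->
  [/\ a * (c - b) = 0, 2 * (a * d) = b * (b + c),
      2 * (a * d) = c * (b + c) & d * (c - b) = 0].
Proof.
move=> ef_basis.
have free_ef : free [tuple e; f] := basis_free ef_basis.
have tens_eq0 (W : vectType k) (u v : W) :
    e \ot u + f \ot v = 0 <-> u = 0 /\ v = 0.
  split=> [uv0|[-> ->]]; last by rewrite !tens0r addr0.
  pose T (i : 'I_2) := if i == 0 :> nat then u else v.
  have T0 : forall i, T i = 0.
    by apply: (free_tens_eq0 free_ef); rewrite !big_ord_recl big_ord0 addr0.
  by split; [apply: (T0 ord0) | apply: (T0 ord_max)].
have comb_eq0 (x y : k) : x *: e + y *: f = 0 <-> x = 0 /\ y = 0.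
  split=> [xy0|[-> ->]]; last by rewrite !scale0r addr0.
  pose z i := if i == 0%N then x else y.
  have z0 : forall i : 'I_2, z i = 0.
    by apply/(freeP free_ef); rewrite !big_ord_recl big_ord0 addr0.
  by split; [apply: (z0 ord0) | apply: (z0 ord_max)].
have e_tens_eq0 (u : L) : e \ot u = 0 <-> u = 0.
  by have := tens_eq0 _ u 0; rewrite tens0r addr0 => ->; split=> [[]|->].
rewrite /CYBE_solution CYBE_lhsE tens_eq0 !e_tens_eq0.
have -> : a *: q - b *: p + D *: f =
    (a * (c - b)) *: e + (2 * (a * d) - b * (b + c)) *: f.
  rewrite !scalerDr !scalerA opprD addrACA -!scalerBl -addrA -scalerDl.
  by congr (_ *: e + _ *: f); rewrite /D; ring.
have -> : c *: q - d *: p - D *: e =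
    (c * (b + c) - 2 * (a * d)) *: e + (d * (c - b)) *: f.
  rewrite !scalerDr !scalerA opprD addrACA -!scalerBl addrAC -scalerBl.
  by congr (_ *: e + _ *: f); rewrite /D; ring.
rewrite !comb_eq0; split=> [[[? /subr0_eq ?] [/subr0_eq ? ?]]|[-> -> <- ->]].
  by split.
by rewrite !subrr.
Qed.

End NormalForm.

End Lie.

(** * The two symmetry conditions on a 2 x 2 coefficient matrix *)

Lemma ord2_ind (P : 'I_2 -> Prop) : P 0 -> P 1 -> forall i, P i.
Proof.
move=> P0 P1 i; have [-> //|i0] := eqVneq i 0.
by have -> : i = 1 by apply/val_inj; case: i i0 => [[|[]]].
Qed.

Section Coefficients.
Variables (k : fieldType) (K : 'M[k]_2).

(** For a symmetric matrix, K i j * K l m = K i l * K j m is the vanishing of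
    the minor on rows i, m and columns j, l; a 2 x 2 matrix has only one minor
    of order 2 up to sign, its determinant. *)
Lemma strongly_symmetric_coef2E :
  strongly_symmetric_coef K <->
  K 0 1 = K 1 0 /\ K 0 0 * K 1 1 = K 0 1 ^+ 2.
Proof.
split=> [[Ksym Kmul]|[K01 K_rank1]].
  by rewrite Kmul expr2.
split.
  by apply: ord2_ind; apply: ord2_ind.
do 4![apply: ord2_ind]; rewrite -?K01 //; ring: K_rank1.
Qed.

Lemma skew_symmetric_coef2E : (2 : k) != 0 ->
  skew_symmetric_coef K <-> [/\ K 0 0 = 0, K 1 1 = 0 & K 0 1 = - K 1 0].
Proof.
move=> two_neq0; split=> [Kskew|[K00 K11 K01]].
  have diag0 i : K i i = 0.
    apply: (mulfI two_neq0); rewrite mulr0 [2 * _]mulr_natl mulr2n.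
    by rewrite {1}Kskew addNr.
  by split.
by apply: ord2_ind; apply: ord2_ind; rewrite ?K00 ?K11 ?K01 ?opprK ?oppr0.
Qed.

End Coefficients.

(** * Solving the equations *)

(** If b <> c, the first and last equations kill a and d, and the difference of
    the two middle ones, (b - c)(b + c) = 0, leaves b = -c. *)
Lemma CYBE_coef2E (k : fieldType) (a b c d : k) : 2 != 0 :> k ->
  [/\ a * (c - b) = 0, 2 * (a * d) = b * (b + c),
      2 * (a * d) = c * (b + c) & d * (c - b) = 0] <->
  (b = c /\ a * d = b ^+ 2) \/ [/\ a = 0, d = 0 & b = - c].
Proof.
move=> two_neq0; split=> [[a_cb ad_b ad_c d_cb]|]; last first.
  by case=> [[<- ad]|[-> -> ->]]; rewrite ?ad; split; ring.
have [bc|bc] := eqVneq b c; [left | right].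
  by split=> //; apply: (mulfI two_neq0); rewrite ad_b -bc; ring.
have cb0 : c - b != 0 by rewrite subr_eq0 eq_sym.
have cancel_cb x : x * (c - b) = 0 -> x = 0.
  by move/eqP; rewrite mulf_eq0 (negPf cb0) orbF => /eqP.
split; [exact: cancel_cb | exact: cancel_cb |].
apply/eqP; rewrite -addr_eq0; apply/eqP/cancel_cb.
by rewrite mulrBr ![(b + c) * _]mulrC -ad_c -ad_b subrr.
Qed.

Theorem proposition1p3 (k : fieldType) (L : finLieAlgType k)
    (char_k : 2%N \notin [pchar k])
    (nonabelian_L : ~ lie_abelian L)
    (dim_L : \dim {:L} = 2%N)
    (r : tensor L L) :
  CYBE_solution r <-> strongly_symmetric r \/ skew_symmetric r.
Proof.
have two_neq0 : 2 != 0 :> k by move: char_k; rewrite inE.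
have [e [f [ef_basis ef]]] := nonabelian_dim2_basis dim_L nonabelian_L.
have [K rK] := tensor_comb_ex r ef_basis.
rewrite (strongly_symmetricE ef_basis rK) (skew_symmetricE ef_basis rK).
rewrite strongly_symmetric_coef2E skew_symmetric_coef2E // -CYBE_coef2E //.
rewrite -(CYBE_solutionE ef) //.
suff -> : r = e \ot (K 0 0 *: e + K 0 1 *: f) + f \ot (K 1 0 *: e + K 1 1 *: f).
  by [].
rewrite rK /tensor_comb !big_ord_recl !big_ord0 !addr0 /=.
have -> : lift ord0 0 = 1 :> 'I_2 by apply/val_inj.
by rewrite !tensDr !tensZr.
Qed.
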